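(* The intersection of finitely many finitely generated left (resp. right) ideals of the algebra $\mathbb{I}_1$ is again a finitely generated left (resp. right) ideal of $\mathbb{I}_1$.
   Context: $K$ is a field of characteristic zero. $\mathbb{I}_1$ is the subalgebra of $\mathrm{End}_K(K[x])$ generated by (multiplication by) $x$, $\partial=\frac{d}{dx}$ and $\int: x^n\mapsto \frac{x^{n+1}}{n+1}$. *)

(* Defs.v *)
From HB Require Import structures.
From mathcomp Require Import all_boot all_algebra.
From mathcomp Require Import boolp classical_sets.

Set Implicit Arguments.
Unset Strict Implicit.
Unset Printing Implicit Defensive.

Import GRing.Theory.
Local Open Scope ring_scope.

(* End_K(K[x]), with pointwise addition and scaling; the product is
   composition, (f * g) p = f (g p). Equality and choice are classical. *)
Definition polyEnd (K : fieldType) : Type := {linear {poly K} -> {poly K}}.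
Identity Coercion linear_of_polyEnd : polyEnd >-> GRing.Linear.type.

Section PolyEndAlgebra.
Variable K : fieldType.
Local Notation E := (polyEnd K).
Implicit Types (f g h : E) (a b : K).

Lemma polyEndP f g : (forall p, f p = g p) -> f = g.
Proof.
case: f g => [f [[[f0 fD]] [fZ]]] [g [[[g0 gD]] [gZ]]] /= /funext fg.
case: _ / fg in g0 gD gZ *.
by rewrite (Prop_irrelevance f0 g0) (Prop_irrelevance fD gD)
           (Prop_irrelevance fZ gZ).
Qed.

HB.instance Definition _ := gen_eqMixin E.
HB.instance Definition _ := gen_choiceMixin E.

Definition polyEnd_zero : E := (\0 : {linear {poly K} -> {poly K}}).
Definition polyEnd_opp f : E := (\- f : {linear {poly K} -> {poly K}}).
Definition polyEnd_add f g : E := (f \+ g : {linear {poly K} -> {poly K}}).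
Definition polyEnd_one : E := (idfun : {linear {poly K} -> {poly K}}).
Definition polyEnd_mul f g : E := (f \o g : {linear {poly K} -> {poly K}}).
Definition polyEnd_scale a f : E := (a \*: f : {linear {poly K} -> {poly K}}).

Fact polyEnd_addA : associative polyEnd_add.
Proof. by move=> f g h; apply: polyEndP => p; apply: addrA. Qed.
Fact polyEnd_addC : commutative polyEnd_add.
Proof. by move=> f g; apply: polyEndP => p; apply: addrC. Qed.
Fact polyEnd_add0 : left_id polyEnd_zero polyEnd_add.
Proof. by move=> f; apply: polyEndP => p; apply: add0r. Qed.
Fact polyEnd_addN : left_inverse polyEnd_zero polyEnd_opp polyEnd_add.
Proof. by move=> f; apply: polyEndP => p; apply: addNr. Qed.

HB.instance Definition _ := GRing.isZmodule.Build E
  polyEnd_addA polyEnd_addC polyEnd_add0 polyEnd_addN.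

Fact polyEnd_mulA : associative polyEnd_mul.
Proof. by move=> f g h; apply: polyEndP. Qed.
Fact polyEnd_mul1l : left_id polyEnd_one polyEnd_mul.
Proof. by move=> f; apply: polyEndP. Qed.
Fact polyEnd_mul1r : right_id polyEnd_one polyEnd_mul.
Proof. by move=> f; apply: polyEndP. Qed.
Fact polyEnd_mulDl : left_distributive polyEnd_mul +%R.
Proof. by move=> f g h; apply: polyEndP. Qed.
Fact polyEnd_mulDr : right_distributive polyEnd_mul +%R.
Proof. by move=> f g h; apply: polyEndP => p; apply: (raddfD f). Qed.
Fact polyEnd_oner_neq0 : polyEnd_one != 0.
Proof.
apply/eqP => /(congr1 (fun f : E => f 1)) /= /eqP.
by rewrite (oner_eq0 {poly K}).
Qed.

HB.instance Definition _ := GRing.Zmodule_isNzRing.Build E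
  polyEnd_mulA polyEnd_mul1l polyEnd_mul1r polyEnd_mulDl polyEnd_mulDr
  polyEnd_oner_neq0.

Fact polyEnd_scaleA a b f :
  polyEnd_scale a (polyEnd_scale b f) = polyEnd_scale (a * b) f.
Proof. by apply: polyEndP => p; apply: scalerA. Qed.
Fact polyEnd_scale1 : left_id 1 polyEnd_scale.
Proof. by move=> f; apply: polyEndP => p; apply: scale1r. Qed.
Fact polyEnd_scaleDr : right_distributive polyEnd_scale +%R.
Proof. by move=> a f g; apply: polyEndP => p; apply: scalerDr. Qed.
Fact polyEnd_scaleDl f : {morph polyEnd_scale^~ f : a b / a + b}.
Proof. by move=> a b; apply: polyEndP => p; apply: scalerDl. Qed.

HB.instance Definition _ := GRing.Zmodule_isLmodule.Build K E
  polyEnd_scaleA polyEnd_scale1 polyEnd_scaleDr polyEnd_scaleDl.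

Fact polyEnd_scaleAl a f g : a *: (f * g) = (a *: f) * g.
Proof. exact: polyEndP. Qed.
Fact polyEnd_scaleAr a f g : a *: (f * g) = f * (a *: g).
Proof. by apply: polyEndP => p; apply: esym; apply: (linearZZ f). Qed.

HB.instance Definition _ := GRing.Lmodule_isLalgebra.Build K E polyEnd_scaleAl.
HB.instance Definition _ := GRing.Lalgebra_isAlgebra.Build K E polyEnd_scaleAr.

End PolyEndAlgebra.

Section Generators.
Variable K : fieldType.

Definition mulX_op : polyEnd K :=
  ('X \*o idfun : {linear {poly K} -> {poly K}}).

Definition deriv_op : polyEnd K := (@deriv K : {linear {poly K} -> {poly K}}).

Definition integ (p : {poly K}) : {poly K} :=
  \sum_(i < size p) p`_i *: (i.+1%:R^-1 *: 'X^(i.+1)).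

Lemma integE n (p : {poly K}) : (size p <= n)%N ->
  integ p = \sum_(i < n) p`_i *: (i.+1%:R^-1 *: 'X^(i.+1)).
Proof.
move=> le_pn; rewrite /integ (big_ord_widen _ (fun i =>
  p`_i *: (i.+1%:R^-1 *: 'X^(i.+1))) le_pn) big_mkcond.
by apply: eq_bigr => i _; case: ltnP => // le_pi; rewrite nth_default ?scale0r.
Qed.

Fact integ_is_linear : linear integ.
Proof.
move=> a p q; set n := maxn (size p) (size q).
have le_apq : (size (a *: p + q)%R <= n)%N.
  rewrite (leq_trans (size_polyD _ _)) // geq_max leq_maxr andbT.
  by rewrite (leq_trans (size_scale_leq _ _)) // leq_maxl.
rewrite !(@integE n) ?leq_maxl ?leq_maxr // scaler_sumr -big_split /=.
by apply: eq_bigr => i _; rewrite coefD coefZ scalerDl (scalerA a).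
Qed.

HB.instance Definition _ :=
  GRing.isLinear.Build K {poly K} {poly K} _ integ integ_is_linear.

Lemma integXn n : integ 'X^n = n.+1%:R^-1 *: 'X^(n.+1).
Proof.
rewrite (@integE n.+1) ?size_polyXn // big_ord_recr /= coefXn eqxx scale1r.
rewrite big1 ?add0r // => i _.
by rewrite coefXn (ltn_eqF (ltn_ord i)) scale0r.
Qed.

Definition integ_op : polyEnd K := (integ : {linear {poly K} -> {poly K}}).

End Generators.

Local Open Scope classical_set_scope.

Section GeneratedSubalgebra.
Variables (K : fieldType) (A : algType K) (G : set A).

(* The intersection of all (unital) K-subalgebras of A containing G. *)
Definition subalg_gen : {pred A} :=
  fun f => `[< forall S : {pred A},
                 subalg_closed S -> G `<=` [set` S] -> f \in S >].

Fact subalg_gen_closed : subalg_closed subalg_gen.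
Proof.
split=> [|a f g /asboolP Gf /asboolP Gg|f g /asboolP Gf /asboolP Gg];
  apply/asboolP => S Salg GS; case: (Salg) => S1 SL SM //.
  by apply: SL; [apply: Gf | apply: Gg].
by apply: SM; [apply: Gf | apply: Gg].
Qed.

Lemma sub_subalg_gen : G `<=` [set` subalg_gen].
Proof. by move=> f Gf; apply/asboolP => S _; apply. Qed.

HB.instance Definition _ :=
  GRing.isSubalgClosed.Build K A subalg_gen subalg_gen_closed.

End GeneratedSubalgebra.

Definition I1_pred (K : fieldType) : {pred polyEnd K} :=
  subalg_gen [set mulX_op K; deriv_op K; integ_op K].

HB.instance Definition _ (K : fieldType) := GRing.SubalgClosed.on (@I1_pred K).

Record I1 (K : fieldType) : Type :=
  MkI1 { I1_val :> polyEnd K; _ : I1_val \in @I1_pred K }.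

HB.instance Definition _ (K : fieldType) := [isSub for @I1_val K].
HB.instance Definition _ (K : fieldType) := [Choice of I1 K by <:].
HB.instance Definition _ (K : fieldType) :=
  [SubChoice_isSubAlgebra of I1 K by <:].

Section OneSidedIdeals.
Variable R : nzRingType.
Implicit Types (I G : set R) (s : seq R).

Definition left_ideal I :=
  [/\ I 0, forall u v, I u -> I v -> I (u + v) & forall a u, I u -> I (a * u)].

Definition right_ideal I :=
  [/\ I 0, forall u v, I u -> I v -> I (u + v) & forall a u, I u -> I (u * a)].

Definition fg_left_ideal I :=
  left_ideal I /\ exists s, I = smallest left_ideal [set` s].

Definition fg_right_ideal I :=
  right_ideal I /\ exists s, I = smallest right_ideal [set` s].

End OneSidedIdeals.

(* Main.v *)
From HB Require Import structures.
Require Import Defs.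
From mathcomp Require Import all_boot all_algebra.
From mathcomp Require Import boolp classical_sets.

(** Write R for the algebra, D, J and X for differentiation, integration and
multiplication by x, and H = X D. On the basis y_n = x^n/n!, D and J are the
two one-sided shifts and H is diagonal, H y_n = n y_n; thus R consists of
infinite matrices that are banded with polynomial entries up to finitely many
columns. The elements of finite rank form an ideal F, and R/F is a skew
Laurent polynomial ring over K[H], a Noetherian domain. The ring R itself is
not Noetherian because of F, so the proof measures how far a left ideal is
from being finitely generated by looking at F.

- Clearing the powers of J: every f has some D^d f of the form
  sum_k c_k(H) D^k with polynomials c_k ([Dn_repr]). Hence left ideals of R
  are controlled, modulo F, by left ideals of the skew polynomial ring
  K[H][D], for which a Hilbert basis argument on leading coefficients works
  ([stable_noetherian]).
- The part of a left ideal that kills all y_n with n >= m is finitely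
  generated for each m, by an echelon argument ([generators_annihilated]).
- If f has infinite rank, its rows contain pivots in all columns beyond some
  bound ([pivot]); multiples of f then reduce any finite rank element to one
  supported on finitely many columns. So every left ideal that is not inside
  F is finitely generated ([infinite_rank_fg]).

A finitely generated left ideal inside F is supported on finitely many columns,
so its intersection with any left ideal is finitely generated
([finite_rank_fgI]). If I and L are not inside F, neither is their
intersection, because R/F is a left Noetherian domain and thus left Ore
([infinite_rankI]); it is then finitely generated.

The statement for right ideals follows by transposing matrices in the basis
y_n: this exchanges D and J, fixes H, and so is an anti-involution of R
([adjoint_exists], [star]). Transposition is also what shows that F may be
described either by D^d f = 0 (finitely many rows) or by f J^e = 0 (finitely
many columns), and hence is a two-sided ideal ([finite_rankP]). *)

Set Implicit Arguments.
Unset Strict Implicit.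
Unset Printing Implicit Defensive.

Import GRing.Theory.
Local Open Scope ring_scope.
Local Open Scope classical_set_scope.

(** * One-sided ideals and anti-involutions *)

Section Ideals.
Variable R : nzRingType.
Implicit Types (I J L T : set R) (s : seq R).

Lemma left_idealN I u : left_ideal I -> I u -> I (- u).
Proof. by case=> _ _ IM Iu; rewrite -mulN1r; apply: IM. Qed.

Lemma left_idealB I u v : left_ideal I -> I u -> I v -> I (u - v).
Proof.
move=> idI Iu Iv; case: (idI) => _ ID _.
by apply: ID => //; apply: left_idealN.
Qed.

Lemma left_idealI I J : left_ideal I -> left_ideal J -> left_ideal (I `&` J).
Proof.
case=> I0 ID IM [J0 JD JM]; split=> [|u v [? ?] [? ?]|a u [? ?]].
- by split.
- by split; [apply: ID | apply: JD].
- by split; [apply: IM | apply: JM].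
Qed.

Lemma left_idealT : left_ideal [set: R]. Proof. by []. Qed.

(** Finite generation in a form that avoids explicit linear combinations; all
later generation arguments have this shape. *)
Lemma fg_left_idealP I : left_ideal I ->
  fg_left_ideal I <-> exists2 s : seq R, [set` s] `<=` I &
    forall T, left_ideal T -> [set` s] `<=` T -> I `<=` T.
Proof.
move=> idI; split=> [[_ [s defI]]|[s sI Is]].
  exists s => [x sx|T idT sT x]; first by rewrite defI => T [_]; apply.
  by rewrite defI; apply.
split=> //; exists s; apply/seteqP; split=> [x Ix T [idT sT]|x]; last exact.
exact: Is Ix.
Qed.

Lemma fg_left_ideal_setT : fg_left_ideal [set: R].
Proof.
apply/fg_left_idealP; first exact: left_idealT.
exists [:: 1] => // T [_ _ TM] T1 x _.
by rewrite -[x]mulr1; apply: TM; apply: T1; rewrite /= mem_head.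
Qed.

Lemma sub_cons a s T : [set` a :: s] `<=` T <-> T a /\ [set` s] `<=` T.
Proof.
split=> [sT|[Ta sT] x] /=.
  by split=> [|x sx]; apply: sT; rewrite /= inE ?eqxx // sx orbT.
by rewrite inE => /orP[/eqP->|/sT].
Qed.

Lemma sub_cat s1 s2 T :
  [set` s1 ++ s2] `<=` T <-> [set` s1] `<=` T /\ [set` s2] `<=` T.
Proof.
split=> [sT|[T1 T2] x] /=; last by rewrite mem_cat => /orP[/T1|/T2].
by split=> x sx; apply: sT; rewrite /= mem_cat sx ?orbT.
Qed.

End Ideals.

Section AntiInvolution.
Variables (R : nzRingType) (star : R -> R).
Hypotheses (starK : involutive star) (starD : {morph star : x y / x + y}).
Hypothesis starM : forall x y, star (x * y) = star y * star x.

Let star0 : star 0 = 0.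
Proof. by apply: (addrI (star 0)); rewrite -starD !addr0. Qed.

Lemma left_ideal_star I : right_ideal I -> left_ideal (star @^-1` I).
Proof.
case=> I0 ID IM; split=> [|u v|a u]; rewrite /preimage /= ?star0 ?starD ?starM //.
  exact: ID.
exact: IM.
Qed.

Lemma right_ideal_star I : left_ideal I -> right_ideal (star @^-1` I).
Proof.
case=> I0 ID IM; split=> [|u v|a u]; rewrite /preimage /= ?star0 ?starD ?starM //.
  exact: ID.
exact: IM.
Qed.

Lemma preimage_starK (I : set R) : star @^-1` (star @^-1` I) = I.
Proof. by apply/seteqP; split=> x; rewrite /preimage /= starK. Qed.

Lemma sub_map_star s (T : set R) :
  [set` map star s] `<=` T <-> [set` s] `<=` star @^-1` T.
Proof.
split=> [sT x sx|sT x] /=; first by apply: sT; apply: map_f.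
by case/mapP=> y sy ->; apply: sT.
Qed.

(** An anti-involution exchanges left and right ideals together with their
generators. *)
Lemma fg_right_ideal_star I :
  fg_right_ideal I <-> fg_left_ideal (star @^-1` I).
Proof.
split=> [[idI [s defI]]|[/right_ideal_star]]; rewrite ?preimage_starK.
  apply/(fg_left_idealP (left_ideal_star idI)).
  exists (map star s) => [|T /right_ideal_star idT].
    by apply/sub_map_star; rewrite preimage_starK defI => x sx T [_]; apply.
  move/sub_map_star=> sT x; rewrite /preimage /= defI => /(_ _ (conj idT sT)).
  by rewrite /preimage /= starK.
move=> idI [s defI]; split=> //; exists (map star s).
rewrite -[LHS]preimage_starK defI; apply/seteqP; split=> x /=.
  move=> Ix T [/left_ideal_star idT /sub_map_star sT].
  by have := Ix _ (conj idT sT); rewrite /preimage /= starK.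
move=> Ix T [/right_ideal_star idT sT]; apply: (Ix (star @^-1` T)).
by split=> //; apply/sub_map_star; rewrite preimage_starK.
Qed.

End AntiInvolution.

(** * A Hilbert basis theorem for the skew polynomials K[H][D] *)

Section SkewHilbertBasis.
Variable K : fieldType.
Implicit Types (S T : set {poly {poly K}}) (c : {poly {poly K}}).

(** The polynomial c in K[H][D] stands for sum_k c_k(H) D^k, with coefficients
on the left. As D p(H) = p(H + 1) D, left multiplication by D is the map
[Dmul] below. *)
Definition shift : {poly {poly K}} -> {poly {poly K}} :=
  map_poly (comp_poly ('X + 1)).
HB.instance Definition _ := GRing.RMorphism.on shift.

Definition Dmul c := shift c * 'X.

Lemma shift1_size (p : {poly K}) : size (p \Po ('X + 1)) = size p.
Proof. by rewrite size_comp_poly2 // -[1]/(1%:P) size_XaddC. Qed.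

Lemma shift1_eq0 (p : {poly K}) : (p \Po ('X + 1) == 0) = (p == 0).
Proof. by rewrite -!size_poly_eq0 shift1_size. Qed.

Lemma size_shift c : size (shift c) = size c.
Proof.
case: (eqVneq c 0) => [->|c0]; first by rewrite rmorph0.
by rewrite size_poly_eq // shift1_eq0 lead_coef_eq0.
Qed.

Lemma Dmul_eq0 c : (Dmul c == 0) = (c == 0).
Proof.
by rewrite /Dmul mulf_eq0 polyX_eq0 orbF -!size_poly_eq0 size_shift.
Qed.

Lemma size_Dmul c : c != 0 -> size (Dmul c) = (size c).+1.
Proof.
move=> c0; rewrite size_mulX ?size_shift //.
by rewrite -size_poly_eq0 size_shift size_poly_eq0.
Qed.

Lemma size_lead_coef_Dmul c :
  size (lead_coef (Dmul c)) = size (lead_coef c).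
Proof.
case: (eqVneq c 0) => [->|c0]; first by rewrite /Dmul rmorph0 mul0r.
rewrite /Dmul lead_coefMX lead_coef_map_eq ?shift1_size //.
by rewrite shift1_eq0 lead_coef_eq0.
Qed.

(** The left ideals of the skew polynomial ring K[H][D]. *)
Definition stable S := [/\ S 0, forall c c', S c -> S c' -> S (c + c'),
  forall p c, S c -> S (p *: c) & forall c, S c -> S (Dmul c)].

Definition lead_minimal w S a := [/\ S a, size a = w.+1 &
  forall c, S c -> size c = w.+1 -> (size (lead_coef a) <= size (lead_coef c))%N].

(** Euclidean division of leading coefficients: subtracting a K[H]-multiple of
a leaves a leading coefficient smaller than that of a, so by minimality of a
the term of degree w disappears. *)
Lemma stable_reduce w S T a : stable S -> stable T -> lead_minimal w S a ->
  T a -> (forall c, S c -> (size c <= w)%N -> T c) ->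
  forall c, S c -> (size c <= w.+1)%N -> T c.
Proof.
move=> [_ SD SZ _] [_ TD TZ _] [Sa sza amin] Ta Tw c Sc szc.
set q := lead_coef a; set p := c`_w %/ q.
have qw : q = a`_w by rewrite /q lead_coefE sza.
(* The remainder of the Euclidean division in degree w. *)
set c' := c + (- p) *: a.
have Sc' : S c' by apply: SD => //; apply: SZ.
have c'w : c'`_w = c`_w %% q.
  rewrite coefD coefZ -qw {1}(divp_eq c`_w q) mulNr addrAC.
  by rewrite -/p subrr add0r.
have szc' : (size c' <= w.+1)%N.
  rewrite (leq_trans (size_polyD _ _)) // geq_max szc.
  by rewrite (leq_trans (size_scale_leq _ _)) // sza.
have q0 : q != 0 by rewrite lead_coef_eq0 -size_poly_eq0 sza.
suff Tc' : T c'.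
  have -> : c = c' + p *: a by rewrite /c' scaleNr subrK.
  by apply: TD => //; apply: TZ.
apply: Tw => //; rewrite leqNgt; apply/negP => lt_w.
have szc'w : size c' = w.+1 by apply/eqP; rewrite eqn_leq szc' lt_w.
have := amin _ Sc' szc'w; rewrite [lead_coef c']lead_coefE szc'w /= c'w leqNgt.
by rewrite ltn_modp q0.
Qed.

Lemma lead_minimal_exists w S c : S c -> size c = w.+1 ->
  exists a, lead_minimal w S a.
Proof.
move=> Sc szc.
pose P n := `[< exists a, [/\ S a, size a = w.+1 & size (lead_coef a) = n] >].
have exP : exists n, P n by exists (size (lead_coef c)); apply/asboolP; exists c.
case: (ex_minnP exP) => n /asboolP[a [Sa sza <-]] amin.
by exists a; split=> // c' Sc' szc'; apply: amin; apply/asboolP; exists c'.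
Qed.

Lemma stable_generators_le w S : stable S ->
  exists2 s : seq {poly {poly K}}, [set` s] `<=` S &
  forall T, stable T -> [set` s] `<=` T ->
  forall c, S c -> (size c <= w)%N -> T c.
Proof.
move=> stS; elim: w => [|w [s sS IH]].
  exists [::] => // T [T0 _ _ _] _ c _.
  by rewrite leqn0 size_poly_eq0 => /eqP->.
have [[a amin]|noa] := pselect (exists a, lead_minimal w S a).
  exists (a :: s) => [|T stT /sub_cons[Ta sT]].
    by apply/sub_cons; split=> //; case: amin.
  exact: stable_reduce stS stT amin Ta (IH T stT sT).
exists s => // T stT sT c Sc; rewrite leq_eqVlt => /orP[/eqP szc|]; last exact: IH.
by case: noa; apply: lead_minimal_exists Sc szc.
Qed.

(** Choose a in S whose leading coefficient has the least degree over all
elements of S. The elements D^k a share this leading degree, so they clear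
all orders above that of a; the orders below need one generator each. *)
Lemma stable_noetherian S : stable S ->
  exists2 s : seq {poly {poly K}}, [set` s] `<=` S &
  forall T, stable T -> [set` s] `<=` T -> S `<=` T.
Proof.
move=> stS; have [[c [Sc c0]]|S0] := pselect (exists c, S c /\ c != 0); last first.
  exists [::] => // T [T0 _ _ _] _ c Sc; case: (eqVneq c 0) => [->//|c0].
  by case: S0; exists c.
pose P n := `[< exists a, [/\ S a, a != 0 & size (lead_coef a) = n] >].
have exP : exists n, P n by exists (size (lead_coef c)); apply/asboolP; exists c.
case: (ex_minnP exP) => n /asboolP[a [Sa a0 szn]] amin.
have [s sS Hs] := stable_generators_le (size a) stS.
exists (a :: s) => [|T stT /sub_cons[Ta sT]]; first exact/sub_cons.
suff Sle k : forall c', S c' -> (size c' <= k + size a)%N -> T c'.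
  by move=> c' Sc'; apply: (Sle (size c')) => //; apply: leq_addr.
elim: k => [|k IH]; first by rewrite add0n; apply: Hs.
have SM e : S e -> S (Dmul e) by case: stS => _ _ _; apply.
have TM e : T e -> T (Dmul e) by case: stT => _ _ _; apply.
have Sj j : [/\ S (iter j Dmul a), size (iter j Dmul a) = (j + size a)%N,
    size (lead_coef (iter j Dmul a)) = n & iter j Dmul a != 0].
  elim: j => [|j [Sj szj ldj j0]] //=; split; first exact: SM.
  - by rewrite size_Dmul // szj.
  - by rewrite size_lead_coef_Dmul.
  - by rewrite Dmul_eq0.
have amink : lead_minimal (k + size a) S (iter k.+1 Dmul a).
  have [Sk szk ldk _] := Sj k.+1; split=> // e Se sze.
  rewrite ldk; apply: amin; apply/asboolP; exists e.
  by split=> //; rewrite -size_poly_eq0 sze.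
apply: (stable_reduce stS stT amink) => //.
by elim: (k.+1) => //= j; apply: TM.
Qed.

End SkewHilbertBasis.

(** * The operators D, J, X and H = X D *)

Section Operators.
Variable K : fieldType.
Local Notation R := (I1 K).
Implicit Types (f g h : R) (p q : {poly K}).

Definition act f p : {poly K} := I1_val f p.

Lemma act_inj f g : act f =1 act g -> f = g.
Proof. by move=> fg; apply/val_inj/polyEndP. Qed.
Lemma actD f g p : act (f + g) p = act f p + act g p. Proof. by []. Qed.
Lemma actN f p : act (- f) p = - act f p. Proof. by []. Qed.
Lemma actM f g p : act (f * g) p = act f (act g p). Proof. by []. Qed.
Lemma actZ a f p : act (a *: f) p = a *: act f p. Proof. by []. Qed.
Lemma act1 p : act 1 p = p. Proof. by []. Qed.
Lemma act0 p : act 0 p = 0. Proof. by []. Qed.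
Fact act_is_linear f : linear (act f).
Proof. by move=> a p q; apply: (linearP (I1_val f)). Qed.
HB.instance Definition _ f :=
  GRing.isLinear.Build K {poly K} {poly K} _ (act f) (act_is_linear f).

Fact mulX_in_I1 : mulX_op K \in @I1_pred K.
Proof. by apply: sub_subalg_gen; left; left. Qed.
Fact deriv_in_I1 : deriv_op K \in @I1_pred K.
Proof. by apply: sub_subalg_gen; left; right. Qed.
Fact integ_in_I1 : integ_op K \in @I1_pred K.
Proof. by apply: sub_subalg_gen; right. Qed.

Definition mulX_I1 : R := MkI1 mulX_in_I1.
Definition deriv_I1 : R := MkI1 deriv_in_I1.
Definition integ_I1 : R := MkI1 integ_in_I1.
Local Notation X := mulX_I1.
Local Notation D := deriv_I1.
Local Notation J := integ_I1.

Lemma actX p : act X p = 'X * p. Proof. by []. Qed.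
Lemma actDeriv p : act D p = p^`(). Proof. by []. Qed.
Lemma actJ p : act J p = integ p. Proof. by []. Qed.

(** The elements that satisfy P form a subalgebra, and R is generated by X, D
and J. *)
Lemma I1_ind (P : R -> Prop) : P 1 ->
  (forall a f g, P f -> P g -> P (a *: f + g)) ->
  (forall f g, P f -> P g -> P (f * g)) ->
  P X -> P D -> P J -> forall f, P f.
Proof.
move=> P1 PL PM PX PD PJ f; case: (f) => u Iu; move/asboolP: (Iu) => Gu.
pose S : {pred polyEnd K} := fun u => `[< exists2 h, I1_val h = u & P h >].
have : u \in S; last first.
  by case/asboolP=> h hu; rewrite (_ : h = MkI1 Iu) //; apply: val_inj.
apply: Gu => [|v [[->|->]|->]]; last 3 first.
- by apply/asboolP; exists X.
- by apply/asboolP; exists D.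
- by apply/asboolP; exists J.
split=> [|a v w /asboolP[g <- Pg] /asboolP[h <- Ph]
         |v w /asboolP[g <- Pg] /asboolP[h <- Ph]]; apply/asboolP.
- by exists 1.
- by exists (a *: g + h) => //; apply: PL.
- by exists (g * h) => //; apply: PM.
Qed.

Definition euler_I1 : R := X * D.
Local Notation H := euler_I1.

(** The projection p |-> p(0), i.e. the matrix unit e_00 in the basis x^n/n!. *)
Definition eps : R := 1 - J * D.

Lemma DX : D * X = X * D + 1.
Proof.
apply: act_inj => p; rewrite actD !actM !actX !actDeriv derivM derivX.
by rewrite mul1r addrC.
Qed.

Lemma DH : D * H = (H + 1) * D.
Proof. by rewrite /euler_I1 mulrA DX. Qed.

(** * Differential operators with coefficients in K[H] *)

Definition evalH : {poly K} -> R := horner_alg H.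
HB.instance Definition _ := GRing.LRMorphism.copy evalH (horner_alg H).

Lemma evalHC a : evalH a%:P = a%:A. Proof. exact: horner_algC. Qed.
Lemma evalHX : evalH 'X = H. Proof. exact: horner_algX. Qed.

Lemma D_evalH p : D * evalH p = evalH (p \Po ('X + 1)) * D.
Proof.
elim/poly_ind: p => [|p a IH]; first by rewrite comp_poly0 !rmorph0 mulr0 mul0r.
rewrite comp_polyD comp_polyM comp_polyX comp_polyC !rmorphD !rmorphM /=.
rewrite rmorphD rmorph1 /= evalHX !evalHC mulrDr mulrA IH -mulrA DH mulrA.
by rewrite mulrDl -scalerAl mul1r -scalerAr mulr1.
Qed.

(** The operator sum_k c_k(H) D^k. *)
Definition diffop (c : {poly {poly K}}) : R := (map_poly evalH c).[D].

Fact diffop_is_additive : additive diffop.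
Proof. by move=> c c'; rewrite /diffop rmorphB hornerD hornerN. Qed.
HB.instance Definition _ := GRing.isZmodMorphism.Build _ _ diffop diffop_is_additive.

Lemma diffop_mulX c : diffop (c * 'X) = diffop c * D.
Proof. by rewrite /diffop rmorphM /= map_polyX hornerMX. Qed.
Lemma diffopC p : diffop p%:P = evalH p.
Proof. by rewrite /diffop map_polyC hornerC. Qed.
Lemma diffopZ p c : diffop (p *: c) = evalH p * diffop c.
Proof. by rewrite /diffop -mul_polyC rmorphM /= map_polyC hornerCM. Qed.

Lemma D_diffop c : D * diffop c = diffop (Dmul c).
Proof.
rewrite diffop_mulX; elim/poly_ind: c => [|c p IH].
  by rewrite /shift rmorph0 !raddf0 mulr0 mul0r.
rewrite /shift rmorphD /= !(raddfD diffop) /= !diffop_mulX diffopC.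
rewrite mulrDr mulrA IH D_evalH rmorphM /= map_polyX diffop_mulX map_polyC diffopC.
by rewrite !mulrDl.
Qed.

Lemma Dn_diffop n c : D ^+ n * diffop c = diffop (iter n (@Dmul K) c).
Proof.
by elim: n => [|n IH]; rewrite ?mul1r // exprS -mulrA IH D_diffop.
Qed.

(** An Ore condition for the powers of D: moving D^n across c(H, D) only
shifts the coefficients. *)
Lemma Dn_diffop_comm n c : exists c', D ^+ n * diffop c = diffop c' * D ^+ n.
Proof.
elim: n => [|n [c' IH]]; first by exists c; rewrite mul1r mulr1.
exists (shift c'); rewrite exprS -mulrA IH mulrA D_diffop diffop_mulX.
by rewrite !mulrA.
Qed.

(** These operators are closed under product, and orders add since K[H] is a
domain on which the shift is injective. *)
Lemma diffop_mul c c' : exists2 c'', diffop c * diffop c' = diffop c'' &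
  c != 0 -> c' != 0 -> (size c'').+1 = (size c + size c')%N.
Proof.
elim/poly_ind: c c' => [|c p IH] c'.
  by exists 0; rewrite ?raddf0 ?mul0r ?eqxx.
have [->|c0] := eqVneq c 0.
  exists (p *: c'); first by rewrite mul0r add0r diffopC diffopZ.
  rewrite mul0r add0r polyC_eq0 => p0 _.
  by rewrite size_scale // size_polyC p0.
have [c1 op1 sz1] := IH (Dmul c').
exists (c1 + p *: c') => [|_ c'0].
  rewrite !(raddfD diffop) /= diffopZ diffop_mulX diffopC mulrDl -mulrA.
  by rewrite D_diffop op1.
have szc1 : size c1 = (size c + size c')%N.
  by apply: succn_inj; rewrite sz1 ?Dmul_eq0 // size_Dmul // addnS.
rewrite size_polyDl ?szc1; last first.
  rewrite (leq_ltn_trans (size_scale_leq _ _)) // -[X in (X < _)%N]add0n.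
  by rewrite ltn_add2r size_poly_gt0.
by rewrite size_MXaddC (negbTE c0).
Qed.

Hypothesis charK0 : [pchar K] =i pred0.

Lemma natK_neq0 n : n.+1%:R != 0 :> K.
Proof. by have /pcharf0P -> := charK0. Qed.

Lemma coef_integ p i :
  (integ p)`_i = if i is j.+1 then p`_j / j.+1%:R else 0.
Proof.
rewrite (@integE _ (maxn (size p) i)) ?leq_maxl // coef_sum.
case: i => [|j]; first by apply: big1 => k _; rewrite !coefE mulr0 mulr0.
have jm : (j < maxn (size p) j.+1)%N by rewrite leq_maxr.
rewrite (bigD1 (Ordinal jm)) //= !coefE eqxx mulr1 big1 ?addr0 // => k kj.
rewrite !coefE eqSS eq_sym -(inj_eq val_inj) /= in kj *.
by rewrite (negbTE kj) !mulr0.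
Qed.

Lemma DJ : D * J = 1.
Proof.
apply: act_inj => p; rewrite actM actDeriv actJ act1; apply/polyP => i.
by rewrite coef_deriv coef_integ /= -[LHS]mulr_natr divfK ?natK_neq0.
Qed.

Lemma act_eps p : act eps p = p.[0]%:P.
Proof.
rewrite actD actN actM actJ actDeriv act1; apply/polyP => i.
rewrite coefB coefC coef_integ horner_coef0; case: i => [|i] /=.
  by rewrite subr0.
by rewrite coef_deriv -[X in X / _]mulr_natr mulfK ?natK_neq0 // subrr.
Qed.

Lemma epsX : eps * X = 0.
Proof. by apply: act_inj => p; rewrite actM act_eps actX hornerM hornerX mul0r. Qed.

Lemma epsJ : eps * J = 0.
Proof. by rewrite mulrBl mul1r -mulrA DJ mulr1 subrr. Qed.

Lemma DnJn n : D ^+ n * J ^+ n = 1.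
Proof.
elim: n => [|n IH]; first by rewrite mulr1.
by rewrite exprSr exprS mulrA -(mulrA _ D) DJ mulr1.
Qed.

Lemma eps_Dn_evalH j p : eps * D ^+ j * evalH p = p.[j%:R] *: (eps * D ^+ j).
Proof.
have epsH : eps * D ^+ j * H = j%:R *: (eps * D ^+ j).
  rewrite -mulrA; elim: j => [|j IH].
    by rewrite mul1r /euler_I1 mulrA epsX mul0r scale0r.
  have -> : D ^+ j.+1 * H = (D ^+ j * H + D ^+ j) * D.
    by rewrite exprSr -mulrA DH mulrA mulrDr mulr1.
  rewrite mulrA mulrDr IH -[X in _ + X]scale1r -scalerDl -scalerAl.
  by rewrite -mulrA -exprSr -natr1.
elim/poly_ind: p => [|p a IH]; first by rewrite rmorph0 mulr0 horner0 scale0r.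
rewrite rmorphD rmorphM /= evalHX evalHC mulrDr mulrA IH -scalerAl epsH.
by rewrite scalerA -scalerAr mulr1 -scalerDl hornerMXaddC.
Qed.

(** eps D^j extracts row j of a matrix in the basis x^n/n!, so this says that
the entry of c(H, D) at place (j, j + k) is c_k(j). *)
Lemma eps_Dn_diffop j c :
  eps * D ^+ j * diffop c = \sum_(k < size c) (c`_k).[j%:R] *: (eps * D ^+ (j + k)).
Proof.
suff H n : (size c <= n)%N -> eps * D ^+ j * diffop c =
    \sum_(k < n) (c`_k).[j%:R] *: (eps * D ^+ (j + k)) by apply: H.
elim: n c => [|n IH] c.
  by rewrite leqn0 size_poly_eq0 => /eqP->; rewrite raddf0 mulr0 big_ord0.
elim/poly_ind: c => [|c p _] szc.
  by rewrite raddf0 mulr0 big1 // => k _; rewrite coef0 horner0 scale0r.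
have szcn : (size c <= n)%N.
  move: szc; rewrite size_MXaddC; case: eqP => [->|_] //=.
  by rewrite size_poly0.
rewrite raddfD /= diffop_mulX diffopC mulrDr mulrA (IH c szcn) eps_Dn_evalH.
rewrite big_ord_recl coefD coefMX coefC /= add0r addn0 addrC; congr (_ + _).
rewrite mulr_suml; apply: eq_bigr => k _.
by rewrite coefD coefMX coefC /= addr0 -scalerAl -mulrA -exprSr addnS.
Qed.

(** * Transposition *)

(** The coordinates in the basis x^n/n!. *)
Definition dcoef i p : K := (p^`(i)).[0].

Lemma act_Dn n p : act (D ^+ n) p = p^`(n).
Proof.
by elim: n => [|n IH]; rewrite ?act1 // exprS actM IH actDeriv derivnS.
Qed.

Lemma dcoefE i p : dcoef i p = p`_i * (i`!)%:R.
Proof. by rewrite /dcoef horner_coef0 coef_derivn addn0 ffactnn mulr_natr. Qed.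

Lemma act_eps_Dn i p : act (eps * D ^+ i) p = (dcoef i p)%:P.
Proof. by rewrite actM act_eps act_Dn. Qed.

Lemma fact_neq0 i : (i`!)%:R != 0 :> K.
Proof. by have := fact_gt0 i; case: (i`!) => // n _; apply: natK_neq0. Qed.

Lemma dcoef_inj p q : (forall i, dcoef i p = dcoef i q) -> p = q.
Proof.
move=> pq; apply/polyP => i; have := pq i.
by rewrite !dcoefE; apply/mulIf/fact_neq0.
Qed.

Lemma dcoef_large i p : (size p <= i)%N -> dcoef i p = 0.
Proof. by move=> szp; rewrite dcoefE nth_default ?mul0r. Qed.

Lemma dcoef_D i p : dcoef i (act D p) = dcoef i.+1 p.
Proof. by rewrite /dcoef derivSn. Qed.

Lemma dcoefS_J i p : dcoef i.+1 (act J p) = dcoef i p.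
Proof. by rewrite -dcoef_D -actM DJ act1. Qed.

Lemma dcoef0_J p : dcoef 0 (act J p) = 0.
Proof. by rewrite dcoefE actJ coef_integ mul0r. Qed.

Lemma dcoef_H i p : dcoef i (act H p) = i%:R * dcoef i p.
Proof.
apply: polyC_inj; rewrite -act_eps_Dn -actM -evalHX eps_Dn_evalH.
by rewrite hornerX actZ act_eps_Dn -mul_polyC polyCM.
Qed.

(** The symmetric bilinear form for which the x^n/n! are orthonormal; adjoints
for it are transposed matrices. *)
Definition pairing p q := \sum_(i < size p) dcoef i p * dcoef i q.

Lemma pairingE n p q : (size p <= n)%N ->
  pairing p q = \sum_(i < n) dcoef i p * dcoef i q.
Proof.
move=> le_pn; rewrite /pairing (big_ord_widen _ (fun i =>
  dcoef i p * dcoef i q) le_pn) big_mkcond.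
by apply: eq_bigr => i _; case: ltnP => // le_pi; rewrite dcoef_large ?mul0r.
Qed.

Lemma pairingC p q : pairing p q = pairing q p.
Proof.
rewrite (@pairingE (maxn (size p) (size q))) ?leq_maxl //.
rewrite (@pairingE (maxn (size p) (size q)) q) ?leq_maxr //.
by apply: eq_bigr => i _; rewrite mulrC.
Qed.

Lemma pairing_linear a p q r :
  pairing r (a *: p + q) = a * pairing r p + pairing r q.
Proof.
rewrite /pairing mulr_sumr -big_split /=; apply: eq_bigr => i _.
by rewrite {2}/dcoef linearP hornerD hornerZ mulrDr mulrCA.
Qed.

Lemma pairing_D p q : pairing (act D p) q = pairing p (act J q).
Proof.
set n := maxn (size (act D p)) (size p).
rewrite (@pairingE n) ?leq_maxl // (@pairingE n.+1 p) ?leqW ?leq_maxr //.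
rewrite big_ord_recl dcoef0_J mulr0 add0r.
by apply: eq_bigr => i _; rewrite dcoef_D dcoefS_J.
Qed.

Lemma pairing_H p q : pairing (act H p) q = pairing p (act H q).
Proof.
set n := maxn (size (act H p)) (size p).
rewrite (@pairingE n) ?leq_maxl // (@pairingE n p) ?leq_maxr //.
by apply: eq_bigr => i _; rewrite !dcoef_H mulrCA mulrA.
Qed.

Definition adjoint f g := forall p q, pairing (act f p) q = pairing p (act g q).

(** X = J D X because X maps into the polynomials without constant term. *)
Lemma X_JH : X = J * (H + 1).
Proof.
by rewrite /euler_I1 -DX mulrA -[J * D](subKr 1) mulrBl mul1r epsX subr0.
Qed.

Lemma adjointC f g : adjoint f g -> adjoint g f.
Proof. by move=> fg p q; rewrite pairingC -fg pairingC. Qed.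

Lemma adjointL a f f' g g' :
  adjoint f f' -> adjoint g g' -> adjoint (a *: f + g) (a *: f' + g').
Proof.
move=> ff gg p q; rewrite !actD !actZ pairing_linear -ff -gg.
by rewrite ![pairing _ q]pairingC pairing_linear.
Qed.

Lemma adjointM f f' g g' :
  adjoint f f' -> adjoint g g' -> adjoint (f * g) (g' * f').
Proof. by move=> ff gg p q; rewrite !actM ff gg. Qed.

Lemma adjoint1 : adjoint 1 1. Proof. by []. Qed.

Lemma adjoint_DJ : adjoint D J. Proof. exact: pairing_D. Qed.

(** A general endomorphism of K[x] has no adjoint, as its matrix need not be
row-finite; but adjoints exist for the generators, and products and linear
combinations inherit them. *)
Lemma adjoint_exists f : exists g, adjoint f g.
Proof.
elim/I1_ind: f => [|a f g [f' ff] [g' gg]|f g [f' ff] [g' gg]|||].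
- by exists 1.
- by exists (a *: f' + g'); apply: adjointL.
- by exists (g' * f'); apply: adjointM.
- exists ((1 *: H + 1) * D).
  have -> : X = J * (1 *: H + 1) by rewrite scale1r -X_JH.
  apply: adjointM; first by apply/adjointC/adjoint_DJ.
  by apply: adjointL; [apply: pairing_H | apply: adjoint1].
- by exists J; apply: adjoint_DJ.
- by exists D; apply/adjointC/adjoint_DJ.
Qed.

Lemma pairing_Jn i p : pairing p (act (J ^+ i) 1) = dcoef i p.
Proof.
elim: i p => [|i IH] p; last by rewrite exprS actM -pairing_D IH dcoef_D.
rewrite act1 (@pairingE (size p).+1) // big_ord_recl big1 => [|j _].
  by rewrite addr0 !dcoefE coef1 !mulr1.
by rewrite [X in _ * X]dcoefE coef1 mul0r mulr0.
Qed.

Lemma adjoint_unique f g g' : adjoint f g -> adjoint f g' -> g = g'.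
Proof.
move=> fg fg'; apply: act_inj => q; apply: dcoef_inj => i.
by rewrite -!pairing_Jn !(pairingC (act _ q)) -fg -fg'.
Qed.

Definition star f : R := projT1 (cid (adjoint_exists f)).

Lemma starP f : adjoint f (star f).
Proof. exact: projT2 (cid (adjoint_exists f)). Qed.

Lemma starK : involutive star.
Proof. by move=> f; apply: adjoint_unique (starP _) _; apply/adjointC/starP. Qed.

Lemma starD : {morph star : f g / f + g}.
Proof.
move=> f g; apply: adjoint_unique (starP _) _.
rewrite -[f]scale1r -[star _]scale1r.
by apply: adjointL; rewrite ?scale1r; apply: starP.
Qed.

Lemma starM f g : star (f * g) = star g * star f.
Proof. by apply: adjoint_unique (starP _) (adjointM (starP f) (starP g)). Qed.

Lemma starDeriv : star D = J.
Proof. exact: adjoint_unique (starP _) adjoint_DJ. Qed.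

Lemma star0 : star 0 = 0.
Proof. by apply: (addrI (star 0)); rewrite -starD !addr0. Qed.

Lemma starDn n : star (D ^+ n) = J ^+ n.
Proof.
elim: n => [|n IH]; first exact: adjoint_unique (starP _) adjoint1.
by rewrite exprS starM IH starDeriv -exprSr.
Qed.

(** * The ideal of finite rank elements *)

(** For elements of the algebra, D^d f = 0 means that the image of f lies in
degree less than d. *)
Definition finite_rank f := exists d, D ^+ d * f = 0.

(** The identity is eps + J D, so an operator is determined by its values on
the constants and on the image of J. *)
Lemma eq0_J f : f * J = 0 -> act f 1 = 0 -> f = 0.
Proof.
move=> fJ f1; have -> : f = f * eps by rewrite mulrBr mulr1 mulrA fJ mul0r subr0.
apply: act_inj => p; rewrite actM act_eps act0.
by rewrite -[_%:P]mulr1 mul_polyC linearZ /= f1 scaler0.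
Qed.

Lemma eq0_JS f m : f * J ^+ m.+1 = 0 -> act f (act (J ^+ m) 1) = 0 ->
  f * J ^+ m = 0.
Proof. by move=> fJ f1; apply: eq0_J => //; rewrite -mulrA -exprSr. Qed.

Lemma finite_rank_J f e : f * J ^+ e = 0 -> finite_rank f.
Proof.
elim: e f => [|e IH] f fJ; first by exists 0%N; rewrite mul1r -[f]mulr1.
set p := act f (act (J ^+ e) 1).
(* D^(size p) kills p, the value of f on the last column. *)
have [d Hd] : finite_rank (D ^+ (size p) * f).
  apply: IH; apply: eq0_JS; first by rewrite -mulrA fJ mulr0.
  rewrite actM -/p act_Dn; apply: dcoef_inj => i.
  by rewrite !dcoefE coef_derivn coef0 nth_default ?leq_addr // mul0rn.
by exists (d + size p)%N; rewrite exprD -mulrA.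
Qed.

(** Finitely many nonzero columns always give finitely many nonzero rows; the
converse is the same fact for the transposed matrix. *)
Lemma finite_rankP f : finite_rank f <-> exists e, f * J ^+ e = 0.
Proof.
split=> [[d df]|[e /finite_rank_J//]].
have /finite_rank_J[e fe] : star f * J ^+ d = 0.
  by rewrite -starDn -starM df star0.
exists e; rewrite -starDn -[f]starK -starM.
by rewrite fe star0.
Qed.

Lemma finite_rankMl f g : finite_rank g -> finite_rank (f * g).
Proof.
by case/finite_rankP=> e ge; apply/finite_rankP; exists e; rewrite -mulrA ge mulr0.
Qed.

Lemma finite_rankB f g : finite_rank f -> finite_rank g -> finite_rank (f - g).
Proof.
move=> [d df] [e eg]; exists (d + e)%N; rewrite mulrBr {1}addnC !exprD -!mulrA df eg.
by rewrite !mulr0 subrr.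
Qed.

Lemma finite_rank_Dn d f : finite_rank (D ^+ d * f) -> finite_rank f.
Proof. by case=> e ef; exists (e + d)%N; rewrite exprD -mulrA. Qed.

Lemma sub_JD_finite_rank d f : finite_rank (f - J ^+ d * (D ^+ d * f)).
Proof. by exists d; rewrite mulrBr (mulrA _ (J ^+ d)) DnJn mul1r subrr. Qed.

(** Modulo finite rank, J is the inverse of D, so that left multiplication by a
high power of D turns every element into a differential operator. *)
Lemma Dn_repr f : exists d c, D ^+ d * f = diffop c.
Proof.
elim/I1_ind: f => [|a f g [d [c df]] [e [c' eg]]|f g [d [c df]] [e [c' eg]]|||].
- by exists 0%N, 1%:P; rewrite mulr1 diffopC rmorph1.
- exists (e + d)%N, (a%:P *: iter e (@Dmul K) c + iter d (@Dmul K) c').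
  rewrite raddfD /= diffopZ evalHC -!Dn_diffop -df -eg.
  rewrite (mulrA _ (D ^+ d)) (mulrA _ (D ^+ e)) -!exprD (addnC d e).
  by rewrite mulrDr -scalerAr -scalerAl mul1r.
- have [c1 c1E] := Dn_diffop_comm e c; have [c2 c2E _] := diffop_mul c1 c'.
  by exists (e + d)%N, c2; rewrite exprD -mulrA (mulrA _ f) df mulrA c1E -mulrA eg.
- exists 1%N, ('X + 1)%:P; rewrite diffopC raddfD /= rmorph1.
  by rewrite evalHX expr1 DX.
- exists 0%N, 'X; rewrite mul1r -[X in diffop X]mul1r.
  by rewrite diffop_mulX diffopC rmorph1 mul1r.
- by exists 1%N, 1%:P; rewrite diffopC rmorph1 DJ.
Qed.

Lemma natK_inj : injective (fun n => n%:R : K).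
Proof.
move=> i j /=; wlog le_ij : i j / (i <= j)%N => [wl|] ij.
  have [le_ij|/ltnW le_ji] := leqP i j; first exact: wl le_ij ij.
  exact/esym/(wl _ _ le_ji)/esym.
apply/eqP; rewrite eqn_leq le_ij -subn_eq0.
by have /pcharf0P <- := charK0; rewrite natrB // ij subrr eqxx.
Qed.

(** In characteristic zero the points 0, 1, 2, ... are distinct, and p has
finitely many roots. *)
Lemma nonzero_eventually p : p != 0 ->
  exists N, forall j, (N <= j)%N -> p.[j%:R] != 0.
Proof.
have [n] := ubnP (size p); elim: n p => // n IH p szp p0.
have [[x /factor_theorem[q pq]]|noroot] := pselect (exists x, root p x); last first.
  by exists 0%N => j _; apply/negP => /eqP pj; case: noroot; exists j%:R; apply/eqP.
have q0 : q != 0 by apply: contraNneq p0 => q0; rewrite pq q0 mul0r.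
have [|N HN] := IH q _ q0.
  by move: szp; rewrite pq size_Mmonic ?monicXsubC // size_XsubC addn2.
have [M HM] : exists M, forall j, (M <= j)%N -> j%:R != x.
  have [[i ix]|nox] := pselect (exists i : nat, i%:R = x).
    exists i.+1 => j; apply: contraTneq; rewrite -ix => /natK_inj->.
    by rewrite ltnn.
  by exists 0%N => j _; apply/eqP => jx; case: nox; exists j.
exists (maxn N M) => j; rewrite geq_max => /andP[/HN Nj /HM Mj].
by rewrite pq hornerM mulf_neq0 // hornerXsubC subr_eq0.
Qed.

(** Row j of c(H, D) ends at column j + w, where w is the order of c, with entry
lead_coef c (j), which is nonzero for large j. *)
Lemma diffop_pivot c : c != 0 -> exists M, forall m, (M <= m)%N ->
  exists r, r * diffop c * J ^+ m.+1 = 0 /\ act (r * diffop c) (act (J ^+ m) 1) = 1.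
Proof.
move=> c0.
have [N HN] : exists N, forall j, (N <= j)%N -> (lead_coef c).[j%:R] != 0.
  by apply: nonzero_eventually; rewrite lead_coef_eq0.
set w := (size c).-1; have szc : size c = w.+1 by rewrite prednK ?size_poly_gt0.
exists (N + w)%N => m leNm; set j := (m - w)%N.
have mE : m = (j + w)%N by rewrite subnK // (leq_trans _ leNm) // leq_addl.
have /HN nzj : (N <= j)%N by rewrite -(leq_add2r w) -mE.
have row_J k n : eps * D ^+ k * J ^+ (k + n) = eps * J ^+ n.
  by rewrite exprD mulrA -(mulrA _ _ (J ^+ k)) DnJn mulr1.
have row0 k n : (k < n)%N -> eps * D ^+ k * J ^+ n = 0.
  move/subnKC <-; rewrite addSnnS row_J exprS mulrA epsJ mul0r //.
pose b := eps * D ^+ j * diffop c.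
have bE : b = \sum_(k < w.+1) (c`_k).[j%:R] *: (eps * D ^+ (j + k)).
  by rewrite /b eps_Dn_diffop szc.
(* Row j, rescaled to have last entry 1. *)
exists ((lead_coef c).[j%:R]^-1 *: (eps * D ^+ j)).
rewrite -scalerAl -/b; split.
  rewrite -scalerAl bE mulr_suml big1 ?scaler0 // => k _.
  by rewrite -scalerAl row0 ?scaler0 // mE ltnS leq_add2l -ltnS.
rewrite actZ -actM bE mulr_suml big_ord_recr big1 => [|k _] /=; last first.
  by rewrite -scalerAl row0 ?scaler0 // mE ltn_add2l.
rewrite add0r -scalerAl -mE -[X in J ^+ X]addn0 row_J mulr1 actZ.
rewrite act_eps hornerC scalerA lead_coefE szc /=.
by rewrite mulVf ?scale1r // -[c`_w]/(c`_w.+1.-1) -szc -lead_coefE.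
Qed.

Lemma diffop_finite_rank c : finite_rank (diffop c) -> c = 0.
Proof.
move=> /finite_rankP[e ce]; apply/eqP; apply: contraPT isT => /diffop_pivot[M HM].
have [r [_ r1]] := HM (maxn M e) (leq_maxl _ _).
move: r1; rewrite -actM -(subnKC (leq_maxr M e)) exprD mulrA -(mulrA r) ce.
by rewrite mulr0 mul0r act0 => /esym/eqP; rewrite oner_eq0.
Qed.

Lemma pivot f : ~ finite_rank f -> exists M, forall m, (M <= m)%N ->
  exists r, r * f * J ^+ m.+1 = 0 /\ act (r * f) (act (J ^+ m) 1) = 1.
Proof.
move=> nf; have [d [c df]] := Dn_repr f.
have /diffop_pivot[M HM] : c != 0.
  by apply/eqP => c0; apply: nf; exists d; rewrite df c0 raddf0.
by exists M => m /HM[r]; rewrite -df mulrA; exists (r * D ^+ d).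
Qed.

(** The quotient by the finite rank elements is a domain: up to powers of D on
the left, f g is a product of two nonzero differential operators. *)
Lemma finite_rank_prime f g :
  ~ finite_rank f -> ~ finite_rank g -> ~ finite_rank (f * g).
Proof.
have nz h d c : ~ finite_rank h -> D ^+ d * h = diffop c -> c != 0.
  by move=> nh dh; apply/eqP => c0; apply: nh; exists d; rewrite dh c0 raddf0.
move=> nf ng fg; have [d [c df]] := Dn_repr f; have [e [c' eg]] := Dn_repr g.
have [c1 c1E] := Dn_diffop_comm e c.
have c10 : c1 != 0.
  apply: contraNneq (nz _ _ _ nf df) => c10; apply/eqP/diffop_finite_rank.
  by exists e; rewrite c1E c10 raddf0 mul0r.
have c'0 := nz _ _ _ ng eg; have [c2 c2E sz2] := diffop_mul c1 c'.
have c20 : c2 = 0.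
  apply: diffop_finite_rank; rewrite -c2E -eg mulrA -c1E -df -!mulrA.
  by do 2 apply: finite_rankMl.
have := sz2 c10 c'0; rewrite c20 size_poly0.
have := size_poly_gt0 c1; have := size_poly_gt0 c'; rewrite c10 c'0.
by case: (size c1) (size c') => // a [] // b _ _; rewrite addnS.
Qed.

(** * Generators of left ideals *)

Implicit Types (L I T : set R).

(** The differential operators in L form a left ideal of K[H][D], hence have
finitely many generators; any f in L agrees up to finite rank with
J^d (D^d f), where D^d f is a differential operator. *)
Lemma generators_mod_finite_rank L : left_ideal L ->
  exists2 s : seq R, [set` s] `<=` L & forall T, left_ideal T -> [set` s] `<=` T ->
    forall f, L f -> exists2 g, T g & finite_rank (f - g).
Proof.
have st T : left_ideal T -> stable [set c | T (diffop c)].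
  case=> T0 TD TM; split=> [|c c'|p c|c] /=.
  - by rewrite raddf0.
  - by rewrite raddfD; apply: TD.
  - by rewrite diffopZ; apply: TM.
  - by rewrite -D_diffop; apply: TM.
move=> idL; have [s sL Hs] := stable_noetherian (st _ idL).
exists (map diffop s) => [_ /mapP[c sc ->]|T idT sT f Lf]; first exact: sL.
(* D^d kills the difference of f and J^d (D^d f). *)
have [d [c df]] := Dn_repr f; exists (J ^+ d * diffop c); last first.
  by rewrite -df; apply: sub_JD_finite_rank.
case: (idT) => _ _; apply; apply: (Hs _ (st _ idT)) => [e se|].
  by apply: sT; apply: map_f.
by rewrite /= -df; case: idL => _ _; apply.
Qed.

Lemma act1_surj p : exists f, act f 1 = p.
Proof.
elim/poly_ind: p => [|p a [f fp]]; first by exists 0.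
exists (X * f + a%:A); rewrite actD actM fp actX actZ act1 mulrC.
by rewrite alg_polyC.
Qed.

(** One step of column elimination: b has its last nonzero column at m, equal to
the constant 1, so a suitable multiple t b has the same column m as f. *)
Lemma reduce_pivot L T b m : left_ideal L -> left_ideal T -> L b -> T b ->
  b * J ^+ m.+1 = 0 -> act b (act (J ^+ m) 1) = 1 ->
  (forall f, L f -> f * J ^+ m = 0 -> T f) ->
  forall f, L f -> f * J ^+ m.+1 = 0 -> T f.
Proof.
move=> idL [_ TD TM] Lb Tb bJ b1 LT f Lf fJ.
have [t t1] := act1_surj (act f (act (J ^+ m) 1)).
rewrite -(subrK (t * b) f); apply: TD; last exact: TM.
apply: LT; first by apply: left_idealB => //; case: idL => _ _; apply.
apply: eq0_JS; first by rewrite mulrBl -mulrA fJ bJ mulr0 subrr.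
by rewrite actD actN actM b1 t1 subrr.
Qed.

(** Echelon form: for each of the finitely many columns keep one element of L
with its last nonzero column there, if there is one. *)
Lemma generators_annihilated L m : left_ideal L ->
  exists2 s : seq R, [set` s] `<=` L & forall T, left_ideal T -> [set` s] `<=` T ->
    forall f, L f -> f * J ^+ m = 0 -> T f.
Proof.
move=> idL; elim: m => [|m [s sL Hs]].
  by exists [::] => // T [T0 _ _] _ f _; rewrite mulr1 => ->.
have [[b [Lb bJ b1]]|nob] := pselect (exists b,
    [/\ L b, b * J ^+ m.+1 = 0 & act b (act (J ^+ m) 1) = 1]).
  exists (b :: s) => [|T idT /sub_cons[Tb sT]]; first exact/sub_cons.
  exact: reduce_pivot idL idT Lb Tb bJ b1 (Hs T idT sT).
exists s => // T idT sT f Lf fJ; apply: Hs => //; apply: eq0_JS => //.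
set p := act f _; apply: contra_notP nob => /eqP p0.
have szp : size p = (size p).-1.+1 by rewrite prednK ?size_poly_gt0.
set n := (size p).-1 in szp; set a := lead_coef p * (n`!)%:R.
have a0 : a != 0 by rewrite mulf_neq0 ?lead_coef_eq0 ?fact_neq0.
have Dp : p^`(n) = a%:P.
  apply/polyP => i; rewrite coef_derivn coefC; case: i => [|i].
    by rewrite addn0 ffactnn /a mulr_natr lead_coefE.
  by rewrite nth_default ?mul0rn // szp addnS ltnS leq_addr.
(* D^n maps p, of degree n, to a nonzero constant. *)
exists (a^-1 *: 1 * D ^+ n * f); split.
- by case: idL => _ _; apply.
- by rewrite -(mulrA _ f) fJ mulr0.
- by rewrite !actM -/p act_Dn Dp actZ act1 -mul_polyC -polyCM mulVf.
Qed.

(** Modulo finite rank L is finitely generated, and only its elements of finite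
rank remain. The pivots of a give reduction steps in all columns beyond M,
leaving the finitely many columns before M to [generators_annihilated]. *)
Lemma infinite_rank_fg L a : left_ideal L -> L a -> ~ finite_rank a ->
  fg_left_ideal L.
Proof.
move=> idL La /pivot[M HM]; apply/(fg_left_idealP idL).
have [s1 s1L Hs1] := generators_mod_finite_rank idL.
have [s2 s2L Hs2] := generators_annihilated M idL.
exists (a :: s1 ++ s2) => [|T idT].
  by apply/sub_cons; split=> //; apply/sub_cat.
case/sub_cons=> Ta /sub_cat[sT1 sT2] f Lf.
have TannM k : forall h, L h -> h * J ^+ (k + M) = 0 -> T h.
  elim: k => [|k IH]; first exact: Hs2.
  have [r [rJ r1]] := HM (k + M)%N (leq_addl _ _); rewrite addSn.
  apply: (reduce_pivot idL idT _ _ rJ r1 IH).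
    by case: idL => _ _; apply.
  by case: idT => _ _; apply.
have [g [Tg Lg] /finite_rankP[e ge]] : exists2 g, (T `&` L) g & finite_rank (f - g).
  apply: Hs1 => //; first exact: left_idealI.
  by move=> x sx; split; [apply: sT1 | apply: s1L].
rewrite -(subrK g f); case: (idT) => _ TD _; apply: TD => //.
apply: (TannM e); first exact: left_idealB.
by rewrite exprD mulrA ge mul0r.
Qed.

(** All elements of I vanish on the columns beyond a bound common to its
generators. *)
Lemma finite_rank_fgI I L : fg_left_ideal I -> left_ideal L ->
  (forall f, I f -> finite_rank f) -> fg_left_ideal (I `&` L).
Proof.
move=> fgI idL finI; have idI := proj1 fgI.
have [s sI Hs] := (fg_left_idealP idI).1 fgI.
have [m Hm] : exists m, forall f, f \in s -> f * J ^+ m = 0.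
  elim: s sI {Hs} => [|f s IH]; first by exists 0%N.
  case/sub_cons=> /finI/finite_rankP[e fe] /IH[m Hm].
  exists (e + m)%N => g; rewrite inE => /orP[/eqP->|/Hm gm].
    by rewrite exprD mulrA fe mul0r.
  by rewrite addnC exprD mulrA gm mul0r.
have Im f : I f -> f * J ^+ m = 0.
  apply: (Hs [set f | f * J ^+ m = 0]); last exact: Hm.
  split=> [|u v um vm|a u um] /=; first exact: mul0r.
    by rewrite mulrDl um vm addr0.
  by rewrite -mulrA um mulr0.
have idIL := left_idealI idI idL; apply/(fg_left_idealP idIL).
have [s' s'IL Hs'] := generators_annihilated m idIL.
by exists s' => // T idT s'T f [If Lf]; apply: (Hs' T) => //; apply: Im.
Qed.

(** The left ideal R b + R b a + ... + R b a^(n-1), in Horner form. *)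
Fixpoint chain a b n : set R :=
  if n is m.+1 then [set f | exists r u, chain a b m u /\ f = r * b + u * a]
  else [set 0].

Lemma chain_left_ideal a b n : left_ideal (chain a b n).
Proof.
elim: n => [|n [C0 CD CM]].
  by split=> [|u v ->->|c u ->] /=; rewrite ?addr0 ?mulr0.
split=> [|_ _ [r [u [Cu ->]]] [r' [u' [Cu' ->]]]|c _ [r [u [Cu ->]]]] /=.
- by exists 0, 0; rewrite !mul0r addr0.
- exists (r + r'), (u + u'); split; first exact: CD.
  by rewrite !mulrDl addrACA.
- by exists (c * r), (c * u); rewrite mulrDr !mulrA; split=> //; apply: CM.
Qed.

Lemma chain_mono a b : {homo chain a b : m n / (m <= n)%N >-> m `<=` n}.
Proof.
apply: homo_leq => [C|C1 C2 C3|n]; [exact: subset_refl|exact: subset_trans|].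
elim: n => [_ ->|n IH _ [r [u [Cu ->]]]] /=.
  by exists 0, 0; rewrite !mul0r addr0.
by exists r, u; split=> //; apply: IH.
Qed.

Lemma chain_bigcup_left_ideal a b : left_ideal (\bigcup_n chain a b n).
Proof.
split=> [|u v [m _ Cu] [n _ Cv]|c u [m _ Cu]].
- by exists 0%N.
- exists (maxn m n) => //; case: (chain_left_ideal a b (maxn m n)) => _ CD _.
  apply: CD; [apply: chain_mono Cu | apply: chain_mono Cv].
    exact: leq_maxl.
  exact: leq_maxr.
- by exists m => //; case: (chain_left_ideal a b m) => _ _; apply.
Qed.

Lemma chain_pow a b n : chain a b n.+1 (b * a ^+ n).
Proof.
elim: n => [|n IH].
  by exists 1, 0; rewrite mul0r addr0 mul1r mulr1.
by exists 0, (b * a ^+ n); rewrite mul0r add0r exprSr mulrA.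
Qed.

(** The Ore condition for a Noetherian domain: if the intersection had finite
rank, the left ideals R b a^n would be independent modulo finite rank,
against the finite generation of their sum. *)
Lemma infinite_rankI I L a b : left_ideal I -> left_ideal L ->
  I a -> L b -> ~ finite_rank a -> ~ finite_rank b ->
  exists2 h, (I `&` L) h & ~ finite_rank h.
Proof.
move=> idI idL Ia Lb na nb; apply: contrapT => noh.
(* A relation modulo finite rank becomes exact after multiplication by D^d. *)
have key r r' : finite_rank (r * b - r' * a) -> finite_rank (r * b).
  case=> d /eqP; rewrite mulrBr subr_eq0 => /eqP dr.
  apply: (@finite_rank_Dn d); apply: contrapT => nr.
  case: noh; exists (D ^+ d * (r * b)) => //; split.
    by rewrite dr mulrA; case: idI => _ _; apply.
  by rewrite mulrA; case: idL => _ _; apply.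
have indep n : forall g, chain a b n g -> ~ finite_rank (b * a ^+ n - g).
  elim: n => [_ ->|n IH _ [r [u [Cu ->]]] fin]; first by rewrite mulr1 subr0.
  have finr : finite_rank (r * b).
    apply: (key _ (b * a ^+ n - u)).
    rewrite -[_ - _]opprK opprB -sub0r; apply: finite_rankB.
      by exists 0%N; rewrite mulr0.
    by rewrite mulrBl -mulrA -exprSr -addrA -opprD [u * a + _]addrC.
  apply: (@finite_rank_prime (b * a ^+ n - u) a) => //; first exact: IH.
  have -> : (b * a ^+ n - u) * a = b * a ^+ n.+1 - (r * b + u * a) - (0 - r * b).
    by rewrite sub0r opprK mulrBl -mulrA -exprSr opprD addrA [RHS]addrAC subrK.
  apply: finite_rankB => //; apply: finite_rankB => //.
  by exists 0%N; rewrite mulr0.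
have idU := chain_bigcup_left_ideal a b.
have [s sU Hs] := generators_mod_finite_rank idU.
have [n sn] : exists n, [set` s] `<=` chain a b n.
  elim: s sU {Hs} => [|f s IH]; first by exists 0%N.
  case/sub_cons=> -[m _ Cf] /IH[n Cs]; exists (maxn m n); apply/sub_cons.
  split; first by apply: chain_mono Cf; apply: leq_maxl.
  by apply: subset_trans Cs _; apply: chain_mono; apply: leq_maxr.
have [|g Cg] := Hs _ (chain_left_ideal a b n) sn (b * a ^+ n).
  by exists n.+1 => //; apply: chain_pow.
exact: indep.
Qed.

Lemma fg_left_idealI I L :
  fg_left_ideal I -> fg_left_ideal L -> fg_left_ideal (I `&` L).
Proof.
move=> fgI fgL; have [idI idL] := (proj1 fgI, proj1 fgL).
have [[a [Ia na]]|finI] := pselect (exists a, I a /\ ~ finite_rank a); last first.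
  apply: finite_rank_fgI => // f If; apply: contrapT => nf.
  by apply: finI; exists f.
have [[b [Lb nb]]|finL] := pselect (exists b, L b /\ ~ finite_rank b); last first.
  rewrite setIC; apply: finite_rank_fgI => // f Lf; apply: contrapT => nf.
  by apply: finL; exists f.
have [h hIL nh] := infinite_rankI idI idL Ia Lb na nb.
exact: infinite_rank_fg (left_idealI idI idL) hIL nh.
Qed.

Lemma fg_left_ideal_bigcap n (I : 'I_n -> set R) :
  (forall i, fg_left_ideal (I i)) -> fg_left_ideal (\bigcap_i I i).
Proof.
elim: n I => [|n IH] I fgI.
  rewrite (_ : \bigcap_i I i = setT); first exact: fg_left_ideal_setT.
  by apply/seteqP; split=> // x _ [].
rewrite (_ : \bigcap_i I i = I ord0 `&` \bigcap_i I (lift ord0 i)).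
  by apply: fg_left_idealI => //; apply: IH.
apply/seteqP; split=> [x Ix|x [I0 Is] i _].
  by split=> [|i _]; apply: Ix.
by case: (unliftP ord0 i) => [j|] -> //; apply: Is.
Qed.

End Operators.

Theorem theorem4p3 (K : fieldType) (charK0 : [pchar K] =i pred0) (n : nat)
    (I : 'I_n -> set (I1 K)) :
  ((forall i, fg_left_ideal (I i)) -> fg_left_ideal (\bigcap_i I i)) /\
  ((forall i, fg_right_ideal (I i)) -> fg_right_ideal (\bigcap_i I i)).
Proof.
split=> fgI; first exact: fg_left_ideal_bigcap.
have rl := fg_right_ideal_star (starK charK0) (starD charK0) (starM charK0).
apply/rl; rewrite preimage_bigcap; apply: fg_left_ideal_bigcap => // i.
exact/rl.
Qed.
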